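(* There exists $a_0>0$ such that for all $a\in(0,a_0)$ there is an even local periodic solution $\varphi\in H^2_{\rm per,s}$ of $$-\Delta\varphi+c\varphi-\varphi^2=0\quad\text{on }\mathbb{T}\times\mathbb{T},$$ where the small-amplitude periodic waves $\varphi$ are given by the expansion $$\begin{aligned}\varphi(x,y)=\;&2+a\cos(x)\cos(y)\\&+\frac18a^2\left(-\frac76+\cos(2x)+\cos(2y)+\frac13\cos(2x)\cos(2y)\right)\\&+\frac1{384}a^3\left(7\big(\cos(3x)\cos(y)+\cos(3y)\cos(x)\big)+\frac12\cos(3x)\cos(3y)\right)+\mathcal{O}(a^4),\end{aligned}$$ and the frequency $c$ is expressed as $$c=2-\frac1{48}a^2+\mathcal{O}(a^4).$$
   Context: $\mathbb{T}=\mathbb{R}/2\pi\mathbb{Z}$; $H^2_{\rm per,s}$ is the space of real-valued functions $f\in H^2(\mathbb{T}\times\mathbb{T})$ with $f(-x,y)=f(x,y)$ and $f(x,-y)=f(x,y)$ a.e. The number $c\in\mathbb{R}$ in the equation is called the frequency of $\varphi$; both $\varphi=\varphi_a$ and $c=c(a)$ depend on $a$. The symbol $\mathcal{O}(a^4)$ refers to $a\to0^+$ (in $H^2_{\rm per,s}$ for $\varphi$). *)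

(* Defs.v *)
From HB Require Import structures.
From mathcomp Require Import all_boot all_order all_algebra.
From mathcomp Require Import all_classical all_reals all_analysis.

Set Implicit Arguments.
Unset Strict Implicit.
Unset Printing Implicit Defensive.

Import Order.TTheory GRing.Theory Num.Theory.
Import numFieldNormedType.Exports.

Local Open Scope classical_set_scope.
Local Open Scope ring_scope.

(* Functions on the torus T x T, T = R / 2 pi Z, are represented by functions
   on R x R that are 2 pi-periodic in each variable; integrals over the torus
   are integrals over the cell [-pi, pi] x [-pi, pi]. *)

Definition periodic2 (R : realType) (f : R * R -> R) : Prop :=
  forall p : R * R,
    f (p.1 + 2 * pi, p.2) = f p /\ f (p.1, p.2 + 2 * pi) = f p.

Definition cell (R : realType) : set (R * R) :=
  `[- pi, pi] `*` `[- pi, pi].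

Notation leb2 R := (@lebesgue_measure R \x @lebesgue_measure R)%E (only parsing).

Definition dx (R : realType) (f : R * R -> R) : R * R -> R :=
  fun p => derive1 (fun s : R => f (s, p.2)) p.1.

Definition dy (R : realType) (f : R * R -> R) : R * R -> R :=
  fun p => derive1 (fun s : R => f (p.1, s)) p.2.

Fixpoint Ck (R : realType) (k : nat) (f : R * R -> R) : Prop :=
  continuous f /\
  match k with
  | 0 => True
  | k'.+1 =>
      [/\ forall p : R * R, derivable (fun s : R => f (s, p.2)) p.1 1,
          forall p : R * R, derivable (fun s : R => f (p.1, s)) p.2 1,
          Ck k' (dx f)
        & Ck k' (dy f)]
  end.

Definition test_function (R : realType) (psi : R * R -> R) : Prop :=
  periodic2 psi /\ forall k : nat, Ck k psi.

Definition L2norm (R : realType) (f : R * R -> R) : \bar R :=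
  'N[leb2 R]_2%:E[EFin \o (f \_ (@cell R))]%E.

Definition L2per (R : realType) (f : R * R -> R) : Prop :=
  [/\ periodic2 f, measurable_fun setT f & (L2norm f < +oo)%E].

(* g is the derivative of order (i, j) of f in the sense of periodic
   distributions. *)
Definition weak_deriv (R : realType) (i j : nat) (f g : R * R -> R) : Prop :=
  forall psi : R * R -> R, test_function psi ->
    \int[leb2 R]_(p in @cell R) (f p * iter i (@dx R) (iter j (@dy R) psi) p)
    = (-1) ^+ (i + j) * \int[leb2 R]_(p in @cell R) (g p * psi p).

(* f is in L^2 and d collects its L^2 weak derivatives up to order 2; the values
   d i j with 2 < i + j are irrelevant. *)
Definition weak_jet2 (R : realType) (f : R * R -> R)
    (d : nat -> nat -> R * R -> R) : Prop :=
  L2per f /\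
  forall i j : nat, (i + j <= 2)%N -> L2per (d i j) /\ weak_deriv i j f (d i j).

Definition H2per (R : realType) (f : R * R -> R) : Prop :=
  exists d : nat -> nat -> R * R -> R, weak_jet2 f d.

(* Weak derivatives are unique almost everywhere, so for f in H^2 the infimum
   is over a single value; it is +oo when f is not in H^2. *)
Definition H2norm (R : realType) (f : R * R -> R) : \bar R :=
  ereal_inf
    [set ((\sum_(i < 3) \sum_(j < 3 | (i + j <= 2)%N) L2norm (d i j) ^+ 2)
            `^ 2^-1)%E
    | d in [set d : nat -> nat -> R * R -> R | weak_jet2 f d]].

Definition H2pers (R : realType) (f : R * R -> R) : Prop :=
  [/\ H2per f,
      {ae leb2 R, forall p, f (- p.1, p.2) = f p}
    & {ae leb2 R, forall p, f (p.1, - p.2) = f p}].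

(* - Delta phi + c phi - phi^2 = 0, an equality of elements of L^2. *)
Definition solves (R : realType) (c : R) (phi : R * R -> R) : Prop :=
  exists2 d : nat -> nat -> R * R -> R, weak_jet2 phi d &
    {ae leb2 R, forall p,
       - (d 2%N 0%N p + d 0%N 2%N p) + c * phi p - phi p ^+ 2 = 0}.

(* e a = O(a ^ n) as a -> 0+, for a nonnegative (possibly infinite) error e. *)
Definition bigO_at_right0 (R : realType) (n : nat) (e : R -> \bar R) : Prop :=
  exists K : R, \forall a \near 0^'+, (e a <= (K * a ^+ n)%:E)%E.

Definition phi_approx (R : realType) (a : R) : R * R -> R := fun p =>
  let x := p.1 in let y := p.2 in
  2 + a * (cos x * cos y)
  + 1 / 8 * a ^+ 2 *
      (- (7 / 6) + cos (2 * x) + cos (2 * y)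
       + 1 / 3 * (cos (2 * x) * cos (2 * y)))
  + 1 / 384 * a ^+ 3 *
      (7 * (cos (3 * x) * cos y + cos (3 * y) * cos x)
       + 1 / 2 * (cos (3 * x) * cos (3 * y))).

Definition c_approx (R : realType) (a : R) : R := 2 - 1 / 48 * a ^+ 2.

(* Main.v *)
(** Lyapunov-Schmidt reduction carried out in the Wiener algebra of cosine
    series. Writing [phi = c + a u] and [c = 2 - a q], the equation becomes
    [(-Delta - 2) u = a (u^2 - q u)], and [q] is fixed by requiring the
    [cos x cos y]-coefficient of [u] to stay equal to 1. On the other even modes
    [-Delta - 2] has an inverse gaining two derivatives, so for small [a] this is
    a contraction for the l^1 norm of the Fourier coefficients. The Picard
    iteration is started at the explicit approximation
    [cos x cos y + a z1 + a^2 z2], which is consistent up to [a^3]: the iterates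
    stay within [O(a^3)] of it, whence the [O(a^4)] errors on [phi] and [c]. Every
    iterate is a trigonometric polynomial, for which weak derivatives come from
    integration by parts; they pass to the uniform limit. *)
Require Import Defs.
From mathcomp Require Import all_boot all_order all_algebra.
From mathcomp Require Import all_classical all_reals all_analysis.
From mathcomp Require Import measurable_realfun zify ring lra.

Set Implicit Arguments.
Unset Strict Implicit.
Unset Printing Implicit Defensive.

Import Order.TTheory GRing.Theory Num.Theory.
Import numFieldNormedType.Exports.

Local Open Scope classical_set_scope.
Local Open Scope ring_scope.

(** * Integration over the periodicity cell *)

Section Torus.
Variable R : realType.
Implicit Types (f g : R * R -> R) (p : R * R).

(** The plane carries the product sigma-algebra, and [U] is the union of the countably many rational
    boxes [B q] that it contains. *)
Lemma open_measurable2 (U : set (R * R)) : open U -> measurable U.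
Proof.
move=> oU.
pose B (q : (rat * rat) * nat) : set (R * R) :=
  ball (ratr q.1.1 : R) (q.2.+1%:R^-1) `*` ball (ratr q.1.2 : R) (q.2.+1%:R^-1).
have mB q : measurable (B q).
  by apply: measurableX; apply: open_measurable; apply: ball_open; rewrite invr_gt0.
suff -> : U = \bigcup_q (if `[< B q `<=` U >] then B q else set0).
  apply: countable_bigcupT_measurable; first exact: countableP.
  by move=> q; case: ifP => _.
apply/seteqP; split=> [[x y] Uxy|z [q _]]; last by case: asboolP => // + Bz; exact.
have /nbhs_ballP[e /= e0 eU] : nbhs (x, y) U by apply: open_nbhs_nbhs.
(* With radius below [e / 2], a box whose centre is within one radius of [(x, y)] stays inside the
   [e]-ball around [(x, y)]. *)
have [n _ nP] : \forall n \near \oo, n.+1%:R^-1 < e / 2.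
  by near=> n; near: n; apply: near_infty_natSinv_lt (PosNum (divr_gt0 e0 (ltr0n _ 2))).
have {nP} nlt : n.+1%:R^-1 < e / 2 := nP n (leqnn n).
have n0 : (0 : R) < n.+1%:R^-1 by rewrite invr_gt0.
have approx (z : R) : exists q : rat, `|ratr q - z| < n.+1%:R^-1.
  have [|q] := @rat_in_itvoo R (z - n.+1%:R^-1) (z + n.+1%:R^-1).
    by rewrite ltrBlDr -addrA ltrDl addr_gt0.
  by rewrite in_itv/= -ltr_distl => qz; exists q.
have [[q1 xq] [q2 yq]] := (approx x, approx y).
exists ((q1, q2), n) => //; rewrite asboolT//.
move=> [s t] [/= sq tq]; apply: eU.
move: xq yq sq tq; rewrite !/ball/= !/ball/= => xq yq sq tq; split => /=.
  by apply: le_lt_trans (ler_distD (ratr q1) _ _) _;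
    rewrite (splitr e) ltrD// ?(distrC x) (lt_trans _ nlt).
by apply: le_lt_trans (ler_distD (ratr q2) _ _) _;
  rewrite (splitr e) ltrD// ?(distrC y) (lt_trans _ nlt).
Unshelve. all: by end_near. Qed.

Lemma continuous_measurable2 f : continuous f -> measurable_fun setT f.
Proof.
move=> /continuousP cf; apply: (measurability _ (RGenOpens.measurableE R)).
move=> _ [_ [a [b ->] <-]]; rewrite setTI; apply: open_measurable2; apply: cf.
exact: interval_open.
Qed.

Let mu := @lebesgue_measure R.

Lemma measurable_cell : measurable (@cell R).
Proof. exact: measurableX. Qed.

Lemma leb2_cell : leb2 R (@cell R) = ((2 * pi) ^+ 2)%:E.
Proof.
rewrite /cell product_measure1E//= lebesgue_measure_itv/= lte_fin.
by rewrite gtrN ?pi_gt0// -EFinD -EFinM; congr EFin; ring.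
Qed.

Lemma bounded_cell_integrable f (B : R) : measurable_fun setT f ->
  (forall p, cell p -> `|f p| <= B) -> (leb2 R).-integrable (@cell R) (EFin \o f).
Proof.
move=> mf fB; apply: measurable_bounded_integrable.
- exact: measurable_cell.
- by have := leb2_cell => /= ->; rewrite ltry.
- exact: measurable_funTS.
- by exists B; split; [exact: num_real|move=> M BM p /fB /le_trans; apply; exact: ltW].
Qed.

Lemma continuous_cell_bounded f : continuous f ->
  exists B : R, forall p, cell p -> `|f p| <= B.
Proof.
move=> cf.
have : compact (f @` @cell R).
  apply: continuous_compact; first exact: continuous_subspaceT.
  by apply: compact_setX; exact: segment_compact.
move=> /compact_bounded[M [_ MB]]; exists (M + 1) => p cp.
by apply: (MB (M + 1)); [rewrite ltrDl|exists p].
Qed.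

Lemma continuous_cell_integrable f : continuous f ->
  (leb2 R).-integrable (@cell R) (EFin \o f).
Proof.
move=> cf; have [B fB] := continuous_cell_bounded cf.
by apply: (bounded_cell_integrable _ fB); exact: continuous_measurable2.
Qed.

Lemma continuous_patch_integrable f : continuous f ->
  (leb2 R).-integrable setT ((EFin \o f) \_ (@cell R)).
Proof.
have mcell : measurable (@cell R : set (measurableTypeR R * measurableTypeR R)).
  exact: measurable_cell.
by move=> cf; apply: (integrable_mkcond _ mcell).1; exact: continuous_cell_integrable.
Qed.

Lemma continuous_slice1 f (y : R) : continuous f -> continuous (fun x => f (x, y)).
Proof.
move=> cf x; apply: (@cvg_comp _ _ _ (fun s => (s, y)) f _ (nbhs (x, y))).
  exact: (@cvg_pair _ _ _ _ (nbhs x) (nbhs y) _ _ _ id (cst y) cvg_id (cvg_cst _)).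
exact: cf.
Qed.

Lemma continuous_slice2 f (x : R) : continuous f -> continuous (fun y => f (x, y)).
Proof.
move=> cf y; apply: (@cvg_comp _ _ _ (fun s => (x, s)) f _ (nbhs (x, y))).
  exact: (@cvg_pair _ _ _ _ (nbhs x) (nbhs y) _ _ _ (cst x) id (cvg_cst _) cvg_id).
exact: cf.
Qed.

Lemma integral_derive1_periodic (h : R -> R) : (forall x, derivable h x 1) ->
  continuous (derive1 h) -> (forall x, h (x + 2 * pi) = h x) ->
  (\int[mu]_(x in `[(- pi)%R, pi]) (derive1 h x)%:E = 0)%E.
Proof.
move=> dh ch ph; have pi0 := pi_gt0 R.
have hc x : h s @[s --> x] --> h x.
  by apply: differentiable_continuous; apply/derivable1_diffP.
rewrite (@continuous_FTC2 R (derive1 h) h)//; last first.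
- by split=> [x _||]; [|exact: cvg_at_right_filter|exact: cvg_at_left_filter].
- exact: continuous_subspaceT.
- lra.
by rewrite -(ph (- pi)) (_ : - pi + 2 * pi = pi) ?subee//; ring.
Qed.

(** Fubini with [x] as inner variable: each slice integrates the derivative of a periodic function
    over a full period. *)
Lemma integral_cell_dx f : (forall p, derivable (fun s => f (s, p.2)) p.1 1) ->
  continuous (dx f) -> periodic2 f -> \int[leb2 R]_(p in @cell R) dx f p = 0.
Proof.
move=> df cdf pf.
have intf := continuous_patch_integrable cdf.
rewrite /Rintegral integral_mkcond -(integral21_prod_meas1 intf).
rewrite integral0_eq//= => y _; rewrite /fubini_G.
have [yc|yc] := boolP (y \in (`[- pi, pi]%classic : set R)); last first.
  rewrite integral0_eq// => x _; rewrite patchE ifF//.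
  by apply/negbTE; apply: contra yc; rewrite !inE => -[].
transitivity (\int[mu]_(x in `[(- pi)%R, pi]) (derive1 (fun s => f (s, y)) x)%:E)%E.
  rewrite [RHS]integral_mkcond; apply: eq_integral => x _.
  rewrite !patchE (_ : ((x, y) \in @cell R) = (x \in (`[- pi, pi]%classic : set R)))//.
  apply/idP/idP; rewrite !inE; first by case.
  by move=> xc; split => //; rewrite -inE.
apply: integral_derive1_periodic => [x||x].
- exact: (df (x, y)).
- exact: continuous_slice1 cdf.
- exact: (pf (x, y)).1.
Qed.

Lemma integral_cell_dy f : (forall p, derivable (fun s => f (p.1, s)) p.2 1) ->
  continuous (dy f) -> periodic2 f -> \int[leb2 R]_(p in @cell R) dy f p = 0.
Proof.
move=> df cdf pf.
have intf := continuous_patch_integrable cdf.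
rewrite /Rintegral integral_mkcond -(integral12_prod_meas1 intf).
rewrite integral0_eq//= => x _; rewrite /fubini_F.
have [xc|xc] := boolP (x \in (`[- pi, pi]%classic : set R)); last first.
  rewrite integral0_eq// => y _; rewrite patchE ifF//.
  by apply/negbTE; apply: contra xc; rewrite !inE => -[].
transitivity (\int[mu]_(y in `[(- pi)%R, pi]) (derive1 (fun s => f (x, s)) y)%:E)%E.
  rewrite [RHS]integral_mkcond; apply: eq_integral => y _.
  rewrite !patchE (_ : ((x, y) \in @cell R) = (y \in (`[- pi, pi]%classic : set R)))//.
  apply/idP/idP; rewrite !inE; first by case.
  by move=> yc; split => //; rewrite -inE.
apply: integral_derive1_periodic => [y||y].
- exact: (df (x, y)).
- exact: continuous_slice2 cdf.
- exact: (pf (x, y)).2.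
Qed.

End Torus.

(** * The algebra of cosine polynomials *)

(* A list of terms [(q, (m, n))] stands for the sum of the [q cos(m x) cos(n y)];
   like terms are not merged, so the norms below depend on the list. *)
Definition cpoly (R : realType) := seq (R * (nat * nat)).

Section CosinePolynomials.
Variable R : realType.
Implicit Types (s : cpoly R) (p : R * R) (g : nat -> nat -> R).

(** Values, derivatives and Fourier coefficients are all of this form, so linearity is proved only
    once. *)
Definition lin g s : R := \sum_(t <- s) t.1 * g t.2.1 t.2.2.

Definition wnorm g s : R := \sum_(t <- s) `|t.1| * g t.2.1 t.2.2.

(** Derivative of order [i] of [cos (m x)] for [i <= 2]; higher orders default to order 2. *)
Definition dcos (i m : nat) (x : R) : R :=
  match i with
  | 0 => cos (m%:R * x)
  | 1 => - m%:R * sin (m%:R * x)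
  | _ => - m%:R ^+ 2 * cos (m%:R * x)
  end.

Definition cev (i j : nat) s p : R :=
  lin (fun m n => dcos i m p.1 * dcos j n p.2) s.

Definition cproj s : R := lin (fun m n => ((m == 1%N) && (n == 1%N))%:R) s.

Definition eigv (m n : nat) : R := m%:R ^+ 2 + n%:R ^+ 2.

Definition l1norm s : R := wnorm (fun _ _ => 1) s.

(** The weight dominates [m ^ i * n ^ j] for [i + j <= 2], so this norm controls all derivatives up
    to order 2 uniformly. *)
Definition w2norm s : R := wnorm (fun m n => 1 + eigv m n) s.

Definition cpscale (q : R) s : cpoly R := [seq (q * t.1, t.2) | t <- s].

Definition dist (m n : nat) : nat := (m - n) + (n - m).

(** The product-to-sum formula in each variable, with frequencies [m + n] and [|m - n|]. *)
Definition tmul (t u : R * (nat * nat)) : cpoly R :=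
  let q := t.1 * u.1 / 4 in
  [:: (q, (t.2.1 + u.2.1, t.2.2 + u.2.2)%N);
      (q, ((t.2.1 + u.2.1)%N, dist t.2.2 u.2.2));
      (q, (dist t.2.1 u.2.1, (t.2.2 + u.2.2)%N));
      (q, (dist t.2.1 u.2.1, dist t.2.2 u.2.2))].

Definition cmul s s' : cpoly R := flatten [seq tmul t u | t <- s, u <- s'].

(* Inverse of [-Delta - 2] on the modes other than [cos x cos y]. *)
Definition cinv s : cpoly R :=
  [seq (t.1 / (eigv t.2.1 t.2.2 - 2), t.2) | t <- s & t.2 != (1, 1)%N].

Lemma lin_cat g s s' : lin g (s ++ s') = lin g s + lin g s'.
Proof. exact: big_cat. Qed.

Lemma wnorm_cat g s s' : wnorm g (s ++ s') = wnorm g s + wnorm g s'.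
Proof. exact: big_cat. Qed.

Lemma lin_scale g q s : lin g (cpscale q s) = q * lin g s.
Proof.
by rewrite /lin big_map mulr_sumr; apply: eq_bigr => t _ /=; rewrite mulrA.
Qed.

Lemma wnorm_scale g q s : wnorm g (cpscale q s) = `|q| * wnorm g s.
Proof.
by rewrite /wnorm big_map mulr_sumr; apply: eq_bigr => t _ /=; rewrite normrM mulrA.
Qed.

Lemma wnorm_ge0 g s : (forall m n, 0 <= g m n) -> 0 <= wnorm g s.
Proof. by move=> g0; apply: sumr_ge0 => t _; rewrite mulr_ge0. Qed.

Lemma ler_wnorm g h s : (forall m n, g m n <= h m n) -> wnorm g s <= wnorm h s.
Proof. by move=> gh; apply: ler_sum => t _; rewrite ler_wpM2l. Qed.

Lemma ler_lin_wnorm g h s :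
  (forall m n, `|g m n| <= h m n) -> `|lin g s| <= wnorm h s.
Proof.
move=> gh; apply: le_trans (ler_norm_sum _ _ _) _.
by apply: ler_sum => t _; rewrite normrM ler_wpM2l.
Qed.

Lemma eigv_ge0 m n : 0 <= eigv m n.
Proof. by rewrite addr_ge0// exprn_ge0. Qed.

Lemma l1norm_ge0 s : 0 <= l1norm s.
Proof. exact: wnorm_ge0. Qed.

Lemma w2norm_ge0 s : 0 <= w2norm s.
Proof. by apply: wnorm_ge0 => m n; rewrite addr_ge0// eigv_ge0. Qed.

Lemma l1norm_le_w2norm s : l1norm s <= w2norm s.
Proof. by apply: ler_wnorm => m n; rewrite lerDl eigv_ge0. Qed.

Lemma ler_cproj s : `|cproj s| <= l1norm s.
Proof. by apply: ler_lin_wnorm => m n; case: (_ && _); rewrite ?normr1 ?normr0. Qed.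

Lemma dcos_bound i m x : (i <= 2)%N -> `|dcos i m x| <= m%:R ^+ i.
Proof.
case: i => [|[|[|//]]] _ /=; rewrite ?normrM ?normrN ?normrX ?normr_nat.
- exact: cos_max.
- by rewrite ler_piMr// sin_max.
- by rewrite ler_piMr ?exprn_ge0// cos_max.
Qed.

Lemma ler_cev i j s p : (i + j <= 2)%N -> `|cev i j s p| <= w2norm s.
Proof.
move=> ij; apply: ler_lin_wnorm => m n.
rewrite normrM; apply: (@le_trans _ _ (m%:R ^+ i * n%:R ^+ j)).
  apply: ler_pM => //; apply: dcos_bound; apply: leq_trans ij;
    by rewrite ?leq_addr ?leq_addl.
rewrite /eigv; move: (m%:R : R) (n%:R : R) => {m n} m n.
(* These squares give [m n <= (m^2 + n^2) / 2] and [m <= (m^2 + 1) / 2], which cover every case. *)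
have := sqr_ge0 (m - n); have := sqr_ge0 m; have := sqr_ge0 n.
have := sqr_ge0 (m - 1); have := sqr_ge0 (n - 1); rewrite !expr2.
by move: ij; case: i => [|[|[|//]]]; case: j => [|[|[|//]]] // _;
  rewrite ?expr0 ?expr1 ?expr2; lra.
Qed.

Lemma lin_mul g s s' : lin g (cmul s s') =
  \sum_(t <- s) \sum_(u <- s') t.1 * u.1 *
    ((g (t.2.1 + u.2.1) (t.2.2 + u.2.2) + g (t.2.1 + u.2.1) (dist t.2.2 u.2.2)
    + g (dist t.2.1 u.2.1) (t.2.2 + u.2.2)
    + g (dist t.2.1 u.2.1) (dist t.2.2 u.2.2)) / 4)%N.
Proof.
rewrite /lin /cmul big_flatten big_allpairs_dep; apply: eq_bigr => t _.
by apply: eq_bigr => u _; rewrite !big_cons big_nil /=; field.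
Qed.

Lemma cos_dist (m n : nat) (x : R) : cos ((dist m n)%:R * x) = cos (m%:R * x - n%:R * x).
Proof.
have [mn|/ltnW mn] := leqP m n.
- have -> : dist m n = (n - m)%N by rewrite /dist (eqP mn).
  by rewrite natrB// mulrBl -opprB cosN.
- have -> : dist m n = (m - n)%N by rewrite /dist (eqP mn) addn0.
  by rewrite natrB// mulrBl.
Qed.

Lemma cev_mul s s' p : cev 0 0 (cmul s s') p = cev 0 0 s p * cev 0 0 s' p.
Proof.
rewrite /cev lin_mul /lin mulr_suml; apply: eq_bigr => t _.
rewrite mulr_sumr; apply: eq_bigr => u _ /=.
by rewrite !cos_dist !cosB !natrD !mulrDl !cosD; field.
Qed.

(** Equality holds because like terms are not merged: each pair of terms yields four terms carrying
    a quarter of the product. *)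
Lemma l1norm_mul s s' : l1norm (cmul s s') = l1norm s * l1norm s'.
Proof.
rewrite /l1norm /wnorm /cmul big_flatten big_allpairs_dep mulr_suml.
apply: eq_bigr => t _; rewrite mulr_sumr; apply: eq_bigr => u _.
by rewrite !big_cons big_nil /= !normrM normfV normr_nat; field.
Qed.

(** The operator [-Delta - 2], whose kernel among the even modes is spanned by [cos x cos y]. *)
Definition lapm2 s p : R := - (cev 2 0 s p + cev 0 2 s p) - 2 * cev 0 0 s p.

Lemma lapm2E s p : lapm2 s p =
  lin (fun m n => (eigv m n - 2) * (cos (m%:R * p.1) * cos (n%:R * p.2))) s.
Proof.
rewrite /lapm2 /cev /lin -big_split/= -sumrN mulr_sumr -sumrB.
by apply: eq_bigr => t _; rewrite /eigv; ring.
Qed.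

Lemma eigv_natE m n : eigv m n = (m ^ 2 + n ^ 2)%N%:R.
Proof. by rewrite natrD !natrX. Qed.

(** Apart from [(1, 1)], no pair has [m^2 + n^2] equal to 2 or 3, so the eigenvalue is at most 1 or
    at least 4. *)
Lemma eigv_gap m n : (m, n) != (1, 1)%N -> 1 + eigv m n <= 3 * `|eigv m n - 2|.
Proof.
move=> mn; rewrite eigv_natE.
have : ((m ^ 2 + n ^ 2 <= 1) || (4 <= m ^ 2 + n ^ 2))%N.
  by move: m n mn => [|[|m]] [|[|n]]// _; rewrite !expnS expn0; lia.
case/orP; rewrite -(ler_nat R); move: (_ %:R) (ler0n R (m ^ 2 + n ^ 2)) => x x0 xb.
- rewrite ler0_norm; lra.
- rewrite ger0_norm; lra.
Qed.

Lemma eigv_neq2 m n : (m, n) != (1, 1)%N -> eigv m n - 2 != 0.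
Proof.
move=> /eigv_gap; apply: contraTneq => ->; rewrite normr0 mulr0 -ltNge.
by rewrite ltr_wpDr// eigv_ge0.
Qed.

Lemma lapm2_cinv s p :
  lapm2 (cinv s) p = cev 0 0 s p - cproj s * (cos p.1 * cos p.2).
Proof.
rewrite lapm2E /cev /cproj /lin big_map big_filter mulr_suml -sumrB big_mkcond.
apply: eq_bigr => -[q [m n]] _ /=.
case: ifPn => /= [mn|/negPn/eqP[-> ->]]; last by rewrite eqxx !mul1r/=; ring.
have := mn; rewrite xpair_eqE => /negbTE ->.
by rewrite /= mulr0 mul0r subr0 mulrA mulfVK// eigv_neq2.
Qed.

Lemma cproj_cinv s : cproj (cinv s) = 0.
Proof.
rewrite /cproj /lin big_map big_filter big1// => -[q [m n]] /=.
by rewrite xpair_eqE => /negbTE ->; rewrite mulr0.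
Qed.

Lemma w2norm_cinv s : w2norm (cinv s) <= 3 * l1norm s.
Proof.
rewrite /w2norm /l1norm /wnorm big_map big_filter mulr_sumr big_mkcond.
apply: ler_sum => -[q [m n]] _ /=; rewrite mulr1.
case: ifPn => mn; last by rewrite mulr_ge0.
rewrite normrM normfV -mulrA mulrC ler_wpM2r// ler_pdivrMl ?normr_gt0 ?eigv_neq2//.
by rewrite mulrC; exact: eigv_gap.
Qed.

End CosinePolynomials.

(** * The Picard iteration *)

Section Iteration.
Variable R : realType.
Implicit Types (u d : cpoly R) (p : R * R) (a q : R).

Definition cc p : R := cos p.1 * cos p.2.

(* [(u, d, q)]: an iterate [u], the increment [d] leading to the next iterate, and
   the value [q] of [(2 - c) / a] attached to [u]. *)
Definition state := (cpoly R * cpoly R * R)%type.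

(** Here [v] represents [u'^2 - u^2]. With [q' = q + cproj v], the expression [u^2 - q u] changes by
    [v - cproj v u' - q d]; every term of this change is controlled by [d]. *)
Definition correction a u d q : state :=
  let u' := u ++ d in let v := cmul (u' ++ u) d in
  (u', cpscale a (cinv (v ++ cpscale (- cproj v) u' ++ cpscale (- q) d)), q + cproj v).

Definition step a (x : state) : state := correction a x.1.1 x.1.2 x.2.

(** The equation is exact: it is the Picard relation between the current iterate and the next
    one. *)
Definition approx_sol a (x : state) : Prop :=
  [/\ cproj x.1.1 = 1, cproj x.1.2 = 0
    & forall p, lapm2 (x.1.1 ++ x.1.2) p =
        a * (cev 0 0 x.1.1 p ^+ 2 - x.2 * cev 0 0 x.1.1 p)].

(** If increments halve, they sum from [d] on to at most [2 * w2norm d]; changes of [q], at most 6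
    times each increment, sum to at most [12 * w2norm d]. Including these tails makes the condition
    invariant. *)
Definition in_ball (x : state) : Prop :=
  l1norm x.1.1 + 2 * w2norm x.1.2 <= 3 /\ `|x.2| + 12 * w2norm x.1.2 <= 2.

Lemma cev_cat i j u d p : cev i j (u ++ d) p = cev i j u p + cev i j d p.
Proof. exact: lin_cat. Qed.

Lemma cev_scale i j q u p : cev i j (cpscale q u) p = q * cev i j u p.
Proof. exact: lin_scale. Qed.

Lemma lapm2_cat u d p : lapm2 (u ++ d) p = lapm2 u p + lapm2 d p.
Proof. by rewrite !lapm2E lin_cat. Qed.

Lemma lapm2_scale q u p : lapm2 (cpscale q u) p = q * lapm2 u p.
Proof. by rewrite !lapm2E lin_scale. Qed.

Lemma cproj_cat u d : cproj (u ++ d) = cproj u + cproj d.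
Proof. exact: lin_cat. Qed.

Lemma cproj_scale q u : cproj (cpscale q u) = q * cproj u.
Proof. exact: lin_scale. Qed.

(* [u'^2 - u^2 = (u' + u) d] for [u' = u + d], and the new [q] is the one for which
   the right-hand side has no [cos x cos y]-component. *)
Lemma step_approx_sol a x : approx_sol a x -> approx_sol a (step a x).
Proof.
move: x => [[u d] q] [/= u1 d0 eqn]; split => /=.
- by rewrite cproj_cat u1 d0 addr0.
- by rewrite cproj_scale cproj_cinv mulr0.
move=> p; rewrite lapm2_cat eqn lapm2_scale lapm2_cinv !cproj_cat !cproj_scale.
by rewrite cproj_cat u1 d0 !cev_cat !cev_scale cev_mul !cev_cat; ring.
Qed.

(** The threshold satisfies [156 = 2 * 3 * 26]: 26 bounds the argument of [cinv] relative to [d], 3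
    is the norm of [cinv], and 2 gives the halving. *)
Lemma step_contract a x : 0 <= a <= 1 / 156 -> in_ball x ->
  [/\ in_ball (step a x), w2norm (step a x).1.2 <= w2norm x.1.2 / 2
    & `|(step a x).2 - x.2| <= 6 * w2norm x.1.2].
Proof.
move: x => [[u d] q] a01; rewrite /in_ball /step /correction /= => -[ub qb].
set v := cmul _ _; set r := v ++ _.
have du := l1norm_le_w2norm d; have u0 := l1norm_ge0 u; have d0 := l1norm_ge0 d.
have u'3 : l1norm (u ++ d) <= 3 by rewrite /l1norm wnorm_cat -!/(l1norm _); lra.
have vd : l1norm v <= 6 * w2norm d.
  rewrite l1norm_mul; apply: ler_pM => //; first exact: l1norm_ge0.
  by rewrite /l1norm wnorm_cat -!/(l1norm _); lra.
have pv := le_trans (ler_cproj v) vd.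
(* The three pieces of [r] contribute 6, [6 * 3] and 2. *)
have rd : l1norm r <= 26 * w2norm d.
  rewrite /r /l1norm !wnorm_cat !wnorm_scale !normrN -!/(l1norm _).
  have : `|cproj v| * l1norm (u ++ d) <= 6 * w2norm d * 3.
    by apply: ler_pM => //; exact: l1norm_ge0.
  have : `|q| * l1norm d <= 2 * w2norm d by apply: ler_pM => //; lra.
  lra.
have d'2 : w2norm (cpscale a (cinv r)) <= w2norm d / 2.
  rewrite /w2norm wnorm_scale -!/(w2norm _) ger0_norm; last by lra.
  have := w2norm_cinv r; have := w2norm_ge0 (cinv r) => r0 rr.
  have : a * w2norm (cinv r) <= 1 / 156 * (3 * (26 * w2norm d)) by apply: ler_pM; lra.
  lra.
have q' := ler_normD q (cproj v).
split => //; last by rewrite addrAC subrr add0r.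
by split; [rewrite /l1norm wnorm_cat -!/(l1norm _)|]; lra.
Qed.

(** * The explicit starting point and its residual *)

Definition e11 : cpoly R := [:: (1, (1, 1)%N)].

Definition z1 : cpoly R :=
  [:: (- 1 / 8, (0, 0)%N); (1 / 8, (2, 0)%N); (1 / 8, (0, 2)%N); (1 / 24, (2, 2)%N)].

(** Second corrector, with source [2 cos x cos y z1] minus its resonant part; the resonant
    coefficient [1 / 48] gives the frequency correction. *)
Definition z2 : cpoly R :=
  [:: (7 / 384, (3, 1)%N); (7 / 384, (1, 3)%N); (1 / 768, (3, 3)%N)].

Definition start a : cpoly R := e11 ++ cpscale a z1 ++ cpscale (a ^+ 2) z2.

(* Modulo [a^3], [start a] solves the equation with [q = a / 48]; [quad a] collects
   the terms of [(start a)^2] of order at least [a^2], divided by [a^2]. *)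
Definition quad0 : cpoly R := cpscale 2 (cmul e11 z2) ++ cmul z1 z1.

Definition quad a : cpoly R :=
  quad0 ++ cpscale a (cpscale 2 (cmul z1 z2) ++ cpscale a (cmul z2 z2)).

(** The defect [a (u^2 - q u) - (-Delta - 2) u] at [u = start a], divided by [a^3], with [q] as in
    [init]. *)
Definition resid a : cpoly R :=
  quad a ++ cpscale (- cproj (quad a)) (start a)
    ++ cpscale (- (1 / 48)) (z1 ++ cpscale a z2).

Definition init a : state :=
  (start a, cpscale (a ^+ 3) (cinv (resid a)), a / 48 + a ^+ 2 * cproj (quad a)).

Lemma cos2x (x : R) : cos (2%:R * x) = 2 * cos x ^+ 2 - 1.
Proof. by rewrite mulr_natl cos_mulr2n mulr_natl. Qed.

Lemma cos3x (x : R) : cos (3%:R * x) = 4 * cos x ^+ 3 - 3 * cos x.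
Proof.
rewrite (_ : 3%:R * x = x *+ 2 + x); last by ring.
rewrite cosD cos_mulr2n sin_mulr2n.
transitivity (2 * cos x ^+ 3 - cos x - 2 * cos x * sin x ^+ 2); first by ring.
by rewrite sin2cos2; ring.
Qed.

Lemma cev_e11 p : cev 0 0 e11 p = cc p.
Proof. by rewrite /cev /lin big_cons big_nil /= !mul1r addr0. Qed.

Lemma cev_z1 p : cev 0 0 z1 p =
  1 / 8 * (- 1 + cos (2 * p.1) + cos (2 * p.2) + 1 / 3 * (cos (2 * p.1) * cos (2 * p.2))).
Proof.
by rewrite /cev /lin !big_cons big_nil /= !mul0r cos0; field.
Qed.

Lemma cev_z2 p : cev 0 0 z2 p =
  1 / 384 * (7 * (cos (3 * p.1) * cos p.2 + cos (3 * p.2) * cos p.1)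
             + 1 / 2 * (cos (3 * p.1) * cos (3 * p.2))).
Proof.
by rewrite /cev /lin !big_cons big_nil /= !mul1r; field.
Qed.

Lemma lapm2_e11 p : lapm2 e11 p = 0.
Proof. by rewrite lapm2E /lin big_cons big_nil /eigv /=; ring. Qed.

Lemma lapm2_z1 p : lapm2 z1 p = cc p ^+ 2.
Proof.
by rewrite lapm2E /lin !big_cons big_nil /eigv /cc /= !mul0r cos0 !cos2x; field.
Qed.

Lemma lapm2_z2 p : lapm2 z2 p = 2 * cc p * cev 0 0 z1 p - 1 / 48 * cc p.
Proof.
by rewrite cev_z1 lapm2E /lin !big_cons big_nil /eigv /cc /= !mul1r !cos3x !cos2x; field.
Qed.

Lemma cproj_start a : cproj (start a) = 1.
Proof.
rewrite /start !cproj_cat !cproj_scale /cproj /lin !big_cons !big_nil /=.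
by ring.
Qed.

(** All modes of [quad0] have even indices, so [(1, 1)] is absent. Hence [q] differs from [a / 48]
    by [O(a^3)], and the frequency error is [O(a^4)]. *)
Lemma cproj_quad0 : cproj quad0 = 0.
Proof.
rewrite /quad0 cproj_cat cproj_scale /cproj !lin_mul /lin !big_cons !big_nil /=.
by ring.
Qed.

Lemma init_approx_sol a : approx_sol a (init a).
Proof.
suff : [/\ cproj (start a) = 1, cproj (cpscale (a ^+ 3) (cinv (resid a))) = 0
    & forall p, lapm2 (start a ++ cpscale (a ^+ 3) (cinv (resid a))) p =
        a * (cev 0 0 (start a) p ^+ 2
             - (a / 48 + a ^+ 2 * cproj (quad a)) * cev 0 0 (start a) p)] by [].
split; [exact: cproj_start|by rewrite cproj_scale cproj_cinv mulr0|move=> p].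
rewrite lapm2_cat lapm2_scale lapm2_cinv.
(* The defect has no resonant part, so [cinv] inverts it exactly. *)
have -> : cproj (resid a) = 0.
  rewrite /resid; move: (quad a) (start a) (cproj_start a) => q u u1.
  rewrite !cproj_cat !cproj_scale cproj_cat cproj_scale u1.
  have -> : cproj z1 = 0 by rewrite /cproj /lin !big_cons big_nil /=; ring.
  have -> : cproj z2 = 0 by rewrite /cproj /lin !big_cons big_nil /=; ring.
  by ring.
rewrite /start !lapm2_cat !lapm2_scale lapm2_e11 lapm2_z1 lapm2_z2 /resid.
move: (cproj (quad a)) => k; rewrite /quad /quad0 /start.
by rewrite !(cev_cat, cev_scale, cev_mul) cev_e11; field.
Qed.

(** The factor 12 is the bound 3 for [cinv] times the bound 4 for [resid a]. *)
Lemma w2norm_init a : 0 <= a <= 1 / 156 ->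
  w2norm (init a).1.2 <= 12 * a ^+ 3 /\ `|(init a).2 - a / 48| <= a ^+ 3.
Proof.
move=> a01; rewrite /init.
have n1 : l1norm (e11 : cpoly R) = 1.
  by rewrite /l1norm /wnorm big_cons big_nil /= normr1; ring.
have n2 : l1norm (z1 : cpoly R) = 5 / 12.
  rewrite /l1norm /wnorm !big_cons big_nil /= mulNr normrN !ger0_norm//; by field.
have n3 : l1norm (z2 : cpoly R) = 29 / 768.
  rewrite /l1norm /wnorm !big_cons big_nil /= [`|7 / 384|]ger0_norm; last by lra.
  by rewrite [`|1 / 768|]ger0_norm; lra.
have ncat u v : l1norm (u ++ v) = l1norm u + l1norm v := wnorm_cat _ u v.
have nsc b u : 0 <= b -> l1norm (cpscale b u) = b * l1norm u.
  by move=> b0; rewrite /l1norm wnorm_scale ger0_norm.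
have a2 : 0 <= a ^+ 2 <= a * (1 / 156) by rewrite expr2; nra.
have a30 : 0 <= a ^+ 3 by rewrite exprn_ge0//; lra.
pose Q := cpscale 2 (cmul z1 z2) ++ cpscale a (cmul z2 z2) : cpoly R.
have nQ : l1norm Q <= 1.
  by rewrite ncat !nsc ?l1norm_mul ?n2 ?n3; lra.
have quadE : quad a = quad0 ++ cpscale a Q by [].
have pq : `|cproj (quad a)| <= a.
  rewrite quadE cproj_cat cproj_quad0 add0r cproj_scale normrM ger0_norm; last lra.
  by rewrite ler_piMr//; [lra|exact: le_trans (ler_cproj _) nQ].
have nq : l1norm (quad a) <= 1.
  rewrite quadE ncat nsc; last by lra.
  rewrite /quad0 ncat nsc; last by lra.
  rewrite !l1norm_mul n1 n2 n3.
  have : a * l1norm Q <= a * 1 by apply: ler_wpM2l nQ; lra.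
  lra.
have nr : l1norm (resid a) <= 4.
  have ns : l1norm (start a) <= 2.
    by rewrite /start !ncat !nsc ?n1 ?n2 ?n3; lra.
  have nz : l1norm (z1 ++ cpscale a z2) <= 1 by rewrite ncat nsc ?n2 ?n3; lra.
  rewrite /resid; move: (quad a) (start a) (z1 ++ cpscale a z2) pq nq ns nz => v u z.
  move=> pq nq ns nz; rewrite !ncat /l1norm !wnorm_scale !normrN -!/(l1norm _).
  have u0 := l1norm_ge0 u; have : `|cproj v| * l1norm u <= a * 2 by apply: ler_pM.
  by rewrite [`|1 / 48|]ger0_norm; lra.
split.
  suff : w2norm (cpscale (a ^+ 3) (cinv (resid a))) <= 12 * a ^+ 3 by [].
  rewrite /w2norm wnorm_scale -!/(w2norm _) ger0_norm// mulrC ler_wpM2r//.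
  by have := w2norm_cinv (resid a); lra.
suff : `|a / 48 + a ^+ 2 * cproj (quad a) - a / 48| <= a ^+ 3 by [].
rewrite addrAC subrr add0r normrM ger0_norm; last by lra.
by rewrite (exprSr a 2) ler_wpM2l//; lra.
Qed.

Lemma init_in_ball a : 0 <= a <= 1 / 156 -> in_ball (init a).
Proof.
move=> a01; have [w q] := w2norm_init a01.
have a2 : 0 <= a ^+ 2 <= a * (1 / 156) by rewrite expr2; nra.
have a3 : 0 <= a ^+ 3 <= a * (1 / 156) by rewrite exprS; nra.
have w0 := w2norm_ge0 (init a).1.2.
split.
- suff : l1norm (start a) <= 2 by rewrite (_ : (init a).1.1 = start a)//; lra.
  rewrite /start /l1norm !wnorm_cat !wnorm_scale /wnorm !big_cons !big_nil /=.
  rewrite [`|-1 / 8|]ler0_norm; last by lra.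
  rewrite [`|7 / 384|]ger0_norm; last by lra.
  rewrite [`|1 / 768|]ger0_norm; last by lra.
  by rewrite !ger0_norm; lra.
- have := ler_normD ((init a).2 - a / 48) (a / 48); rewrite subrK.
  by rewrite (ger0_norm (_ : 0 <= a / 48)); lra.
Qed.

End Iteration.

(** * Weak derivatives of limits of cosine polynomials *)

Section GeometricLimits.
Variable R : realType.
Implicit Types (x : nat -> R) (B : R).

Lemma cvg_dist_geometric x (l B : R) :
  (forall n, `|x n - l| <= B / 2 ^+ n) -> x @ \oo --> l.
Proof.
move=> xl; have B0 : (fun n => B / 2 ^+ n) @ \oo --> (0 : R).
  rewrite (_ : (fun _ => _) = geometric B 2^-1); last first.
    by apply/funext => n /=; rewrite exprVn.
  by apply: cvg_geometric; rewrite ger0_norm ?invf_lt1// ltr1n.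
apply: (squeeze_cvgr (f := fun n => l - B / 2 ^+ n) (h := fun n => l + B / 2 ^+ n)).
- by near=> n; rewrite -ler_distl.
- by rewrite -[X in _ --> X]subr0; apply: cvgB => //; exact: cvg_cst.
- by rewrite -[X in _ --> X]addr0; apply: cvgD => //; exact: cvg_cst.
Unshelve. all: by end_near. Qed.

Lemma cvg_increments_geometric x B : (forall n, `|x n.+1 - x n| <= B / 2 ^+ n) ->
  x @ \oo --> lim (x @ \oo) /\ forall n, `|lim (x @ \oo) - x n| <= 2 * B / 2 ^+ n.
Proof.
move=> xB; have cx : cvg (x @ \oo).
  have -> : x = (fun n => x 0%N + series (telescope x) n).
    by apply/funext => n; rewrite -eq_sum_telescope.
  apply: is_cvgD; first exact: is_cvg_cst.
  apply: normed_cvg; apply: (@series_le_cvg _ _ (geometric B 2^-1)).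
  - by move=> n; exact: normr_ge0.
  - by move=> n; rewrite /= exprVn; exact: le_trans (xB n).
  - by move=> n; rewrite [leRHS]/= exprVn; exact: xB.
  - by apply: is_cvg_geometric_series; rewrite ger0_norm ?invf_lt1// ltr1n.
split => // n.
(* The partial geometric sum is kept in closed form so that the induction closes. *)
have tail k : `|x (n + k)%N - x n| <= 2 * B / 2 ^+ n - 2 * B / 2 ^+ (n + k).
  elim: k => [|k ih]; first by rewrite addn0 !subrr normr0.
  apply: le_trans (ler_distD (x (n + k)%N) _ _) _.
  have := xB (n + k)%N; rewrite addnS exprS invfM => xBk.
  by have := lerD xBk ih; lra.
have B0 : 0 <= B by have := xB 0%N; rewrite expr0 divr1; exact: le_trans.
have cn : (fun m => `|x m - x n|) @ \oo --> `|lim (x @ \oo) - x n|.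
  by apply: cvg_norm; apply: cvgB => //; exact: cvg_cst.
rewrite -(cvg_lim _ cn)//; apply: limr_le; first exact: cvgP cn.
near=> m; have nm : (n <= m)%N by near: m; exact: nbhs_infty_ge.
rewrite -(subnKC nm); apply: le_trans (tail _) _.
by rewrite gerBl divr_ge0// mulr_ge0.
Unshelve. all: by end_near. Qed.

End GeometricLimits.

(** * Integration by parts of cosine polynomials against test functions *)

Section TestFunctions.
Variable R : realType.
Implicit Types (psi : R * R -> R) (s : cpoly R).

Lemma derive1_periodic (f : R -> R) (c x : R) :
  (forall t, f (t + c) = f t) -> derive1 f (x + c) = derive1 f x.
Proof.
move=> fc; rewrite /derive1.
rewrite (_ : (fun h => h^-1 *: (f (h + (x + c)) - f (x + c))) =
             (fun h => h^-1 *: (f (h + x) - f x)))//.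
by apply/funext => h; rewrite addrA !fc.
Qed.

Lemma test_function_dx psi : test_function psi -> test_function (dx psi).
Proof.
move=> [per ck]; split=> [[x y]|k]; last by have [_ []] := ck k.+1.
split; rewrite /dx /=; last first.
  by congr (derive1 _ x); apply/funext => t; exact: (per (t, y)).2.
by apply: derive1_periodic => t; exact: (per (t, y)).1.
Qed.

Lemma test_function_dy psi : test_function psi -> test_function (dy psi).
Proof.
move=> [per ck]; split=> [[x y]|k]; last by have [_ []] := ck k.+1.
split; rewrite /dy /=.
  by congr (derive1 _ y); apply/funext => t; exact: (per (x, t)).1.
by apply: derive1_periodic => t; exact: (per (x, t)).2.
Qed.

Lemma test_function_continuous psi : test_function psi -> continuous psi.
Proof. by move=> [_ /(_ 0%N)[]]. Qed.

Lemma continuous_dcos i m : continuous (@dcos R i m).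
Proof.
have cm : continuous (fun x : R => m%:R * x) by exact: mulrl_continuous.
move=> x; case: i => [|[|i]] /=.
- by apply: continuous_comp; [exact: cm|exact: continuous_cos].
- apply: cvgM; first exact: cvg_cst.
  by apply: continuous_comp; [exact: cm|exact: continuous_sin].
- apply: cvgM; first exact: cvg_cst.
  by apply: continuous_comp; [exact: cm|exact: continuous_cos].
Qed.

Lemma cev_nil i j : cev i j [::] = cst (0 : R).
Proof. by apply/funext => p; rewrite /cev /lin big_nil. Qed.

Lemma cev_cons i j t s p : cev i j (t :: s) p =
  t.1 * (dcos i t.2.1 p.1 * dcos j t.2.2 p.2) + cev i j s p.
Proof. by rewrite /cev /lin big_cons. Qed.

Lemma continuous_cev i j s : continuous (cev i j s).
Proof.
elim: s => [|t s ih] p.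
  by rewrite cev_nil; exact: cvg_cst.
rewrite (funext (cev_cons i j t s)).
apply: cvgD; last exact: ih.
apply: cvgM; first exact: cvg_cst.
apply: cvgM.
- by apply: (continuous_comp (f := fst)); [exact: cvg_fst|exact: continuous_dcos].
- by apply: (continuous_comp (f := snd)); [exact: cvg_snd|exact: continuous_dcos].
Qed.

Lemma is_derive_dcos i m (x : R) : (i < 2)%N ->
  is_derive x 1 (dcos i m) (dcos i.+1 m x).
Proof.
have dm : is_derive x 1 (fun y : R => m%:R * y) m%:R.
  apply: (is_derive_eq (is_deriveZ m%:R (is_derive_id x 1))).
  by rewrite /GRing.scale/= mulr1.
case: i => [|[|//]] _ /=.
- have := is_derive1_comp (is_derive_cos _) dm.
  by rewrite mulrC => /is_derive_eq; apply; ring.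
- have := is_derive1_comp (is_derive_sin _) dm.
  by move=> /(is_deriveZ (- m%:R))/is_derive_eq; apply; rewrite /GRing.scale/=; ring.
Qed.

Lemma is_derive_cev1 i j s (x y : R) : (i < 2)%N ->
  is_derive x 1 (fun t => cev i j s (t, y)) (cev i.+1 j s (x, y)).
Proof.
move=> i2; elim: s => [|t s ih]; first by rewrite !cev_nil; exact: is_derive_cst.
rewrite cev_cons (_ : (fun _ => _) =
  (t.1 * dcos j t.2.2 y) \*: dcos i t.2.1 + (fun r => cev i j s (r, y))).
  apply: (is_deriveD _ ih).
  apply: (is_derive_eq (is_deriveZ _ (is_derive_dcos t.2.1 x i2))).
  by rewrite /GRing.scale/=; ring.
apply/funext => r; rewrite cev_cons.
by transitivity (t.1 * dcos j t.2.2 y * dcos i t.2.1 r + cev i j s (r, y)); [ring|].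
Qed.

Lemma is_derive_cev2 i j s (x y : R) : (j < 2)%N ->
  is_derive y 1 (fun t => cev i j s (x, t)) (cev i j.+1 s (x, y)).
Proof.
move=> j2; elim: s => [|t s ih]; first by rewrite !cev_nil; exact: is_derive_cst.
rewrite cev_cons (_ : (fun _ => _) =
  (t.1 * dcos i t.2.1 x) \*: dcos j t.2.2 + (fun r => cev i j s (x, r))).
  apply: (is_deriveD _ ih).
  apply: (is_derive_eq (is_deriveZ _ (is_derive_dcos t.2.2 y j2))).
  by rewrite /GRing.scale/=; ring.
apply/funext => r; rewrite cev_cons.
by transitivity (t.1 * dcos i t.2.1 x * dcos j t.2.2 r + cev i j s (x, r)); [ring|].
Qed.

Lemma periodic2_cev i j s : periodic2 (cev i j s).
Proof.
have pd k m x : @dcos R k m (x + 2 * pi) = dcos k m x.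
  have e : m%:R * (x + 2 * pi) = m%:R * x + (pi *+ 2) *+ m.
    by rewrite mulrDr -(mulr_natl (pi *+ 2)) -(mulr_natl pi).
  case: k => [|[|k]] /=; rewrite e ?(periodicn (@cosD2pi R)) //.
  by rewrite (periodicn (@sinD2pi R)).
by move=> [x y]; split; rewrite /cev /lin; apply: eq_bigr => t _ /=; rewrite pd.
Qed.

Lemma integral_cev_dx i j s psi : (i < 2)%N -> test_function psi ->
  \int[leb2 R]_(p in @cell R) (cev i j s p * dx psi p) =
  - \int[leb2 R]_(p in @cell R) (cev i.+1 j s p * psi p).
Proof.
move=> i2 tpsi; have cpsi := test_function_continuous tpsi.
have cdpsi := test_function_continuous (test_function_dx tpsi).
have [per /(_ 1%N)[_ [dpsi _ _ _]]] := tpsi.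
(* The product is periodic, so the integral of its derivative over the cell vanishes. *)
pose f p := cev i j s p * psi p.
have df (p : R * R) : is_derive p.1 1 (fun t => f (t, p.2))
    (cev i.+1 j s p * psi p + cev i j s p * dx psi p).
  case: p => x y; have dc := is_derive_cev1 j s x y i2.
  have dp : is_derive x 1 (fun t => psi (t, y)) (dx psi (x, y)).
    by rewrite /dx derive1E; exact/derivableP/(dpsi (x, y)).
  by apply: (is_derive_eq (is_deriveM dc dp)); rewrite /GRing.scale/=; ring.
have dfE : dx f = fun p => cev i.+1 j s p * psi p + cev i j s p * dx psi p.
  by apply/funext => p; rewrite /dx derive1E; have [_ ->] := df p.
have c1 : continuous (fun p => cev i.+1 j s p * psi p).
  by move=> p; apply: cvgM; [exact: continuous_cev|exact: cpsi].
have c2 : continuous (fun p => cev i j s p * dx psi p).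
  by move=> p; apply: cvgM; [exact: continuous_cev|exact: cdpsi].
have := @integral_cell_dx R f; rewrite dfE RintegralD; last first.
- exact: continuous_cell_integrable.
- exact: continuous_cell_integrable.
- exact: measurable_cell.
move=> H; apply/eqP; rewrite -addr_eq0 addrC; apply/eqP; apply: H.
- by move=> p; have [] := df p.
- by move=> p; apply: cvgD; [exact: c1|exact: c2].
- by move=> p; have [c1' c2'] := periodic2_cev i j s p; have [p1 p2] := per p;
    rewrite /f c1' c2' p1 p2.
Qed.

Lemma integral_cev_dy i j s psi : (j < 2)%N -> test_function psi ->
  \int[leb2 R]_(p in @cell R) (cev i j s p * dy psi p) =
  - \int[leb2 R]_(p in @cell R) (cev i j.+1 s p * psi p).
Proof.
move=> j2 tpsi; have cpsi := test_function_continuous tpsi.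
have cdpsi := test_function_continuous (test_function_dy tpsi).
have [per /(_ 1%N)[_ [_ dpsi _ _]]] := tpsi.
pose f p := cev i j s p * psi p.
have df (p : R * R) : is_derive p.2 1 (fun t => f (p.1, t))
    (cev i j.+1 s p * psi p + cev i j s p * dy psi p).
  case: p => x y; have dc := is_derive_cev2 i s x y j2.
  have dp : is_derive y 1 (fun t => psi (x, t)) (dy psi (x, y)).
    by rewrite /dy derive1E; exact/derivableP/(dpsi (x, y)).
  by apply: (is_derive_eq (is_deriveM dc dp)); rewrite /GRing.scale/=; ring.
have dfE : dy f = fun p => cev i j.+1 s p * psi p + cev i j s p * dy psi p.
  by apply/funext => p; rewrite /dy derive1E; have [_ ->] := df p.
have c1 : continuous (fun p => cev i j.+1 s p * psi p).
  by move=> p; apply: cvgM; [exact: continuous_cev|exact: cpsi].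
have c2 : continuous (fun p => cev i j s p * dy psi p).
  by move=> p; apply: cvgM; [exact: continuous_cev|exact: cdpsi].
have := @integral_cell_dy R f; rewrite dfE RintegralD; last first.
- exact: continuous_cell_integrable.
- exact: continuous_cell_integrable.
- exact: measurable_cell.
move=> H; apply/eqP; rewrite -addr_eq0 addrC; apply/eqP; apply: H.
- by move=> p; have [] := df p.
- by move=> p; apply: cvgD; [exact: c1|exact: c2].
- by move=> p; have [c1' c2'] := periodic2_cev i j s p; have [p1 p2] := per p;
    rewrite /f c1' c2' p1 p2.
Qed.

Lemma test_function_iter_dy k psi :
  test_function psi -> test_function (iter k (@dy R) psi).
Proof. by move=> tpsi; elim: k => [//|k]; exact: test_function_dy. Qed.

Lemma test_function_iter_dx k psi :
  test_function psi -> test_function (iter k (@dx R) psi).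
Proof. by move=> tpsi; elim: k => [//|k]; exact: test_function_dx. Qed.

Lemma integral_cev_iter_dx i j k s psi : (i + k <= 2)%N -> test_function psi ->
  \int[leb2 R]_(p in @cell R) (cev i j s p * iter k (@dx R) psi p) =
  (-1) ^+ k * \int[leb2 R]_(p in @cell R) (cev (i + k) j s p * psi p).
Proof.
move=> + tpsi; elim: k i => [|k ih] i ik; first by rewrite addn0 mul1r.
rewrite /= integral_cev_dx; last 2 first.
- by rewrite -ltnS (leq_ltn_trans _ (_ : i + k.+1 < 3)%N)// -addn1 leq_add2l.
- exact: test_function_iter_dx.
by rewrite ih ?addSnnS// exprS mulN1r mulNr.
Qed.

Lemma integral_cev_iter_dy i j k s psi : (j + k <= 2)%N -> test_function psi ->
  \int[leb2 R]_(p in @cell R) (cev i j s p * iter k (@dy R) psi p) =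
  (-1) ^+ k * \int[leb2 R]_(p in @cell R) (cev i (j + k) s p * psi p).
Proof.
move=> + tpsi; elim: k j => [|k ih] j jk; first by rewrite addn0 mul1r.
rewrite /= integral_cev_dy; last 2 first.
- by rewrite -ltnS (leq_ltn_trans _ (_ : j + k.+1 < 3)%N)// -addn1 leq_add2l.
- exact: test_function_iter_dy.
by rewrite ih ?addSnnS// exprS mulN1r mulNr.
Qed.

Lemma weak_deriv_cev i j s : (i + j <= 2)%N -> weak_deriv i j (cev 0 0 s) (cev i j s).
Proof.
move=> ij psi tpsi; rewrite integral_cev_iter_dx ?add0n; last 2 first.
- exact: leq_trans (leq_addr _ _) ij.
- exact: test_function_iter_dy.
rewrite integral_cev_iter_dy ?add0n// ?(leq_trans (leq_addl _ _) ij)//.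
by rewrite mulrA -exprD.
Qed.

End TestFunctions.

(** * Norms in [L^2] and [H^2] bounded by uniform norms *)

Section SobolevBounds.
Variable R : realType.
Implicit Types (f : R * R -> R) (K M : R).

Lemma L2norm_le f K : 0 <= K -> measurable_fun setT f -> (forall p, `|f p| <= K) ->
  (L2norm f <= (K * (2 * pi))%:E)%E.
Proof.
move=> K0 mf fK; rewrite /L2norm unlock /=.
have pi0 := pi_ge0 R.
(* The cell has area [(2 pi)^2]; writing the bound as a square root reduces the claim to comparing
   integrals. *)
have -> : ((K * (2 * pi))%:E = ((K ^+ 2)%:E * leb2 R (@cell R)) `^ 2^-1)%E.
  have -> : leb2 R (@cell R) = ((2 * pi) ^+ 2)%:E := leb2_cell R.
  rewrite -EFinM -exprMn poweR_EFin -powR_mulrn; last by rewrite !mulr_ge0.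
  by rewrite -powRrM mulfV// powRr1// !mulr_ge0.
apply: gt0_ler_poweR; rewrite ?in_itv/= ?leey ?andbT//.
- by apply: integral_ge0 => p _; rewrite lee_fin powR_ge0.
- by rewrite mule_ge0// lee_fin exprn_ge0.
have mcell : measurable (@cell R : set (measurableTypeR R * measurableTypeR R)).
  exact: measurable_cell.
rewrite -(integral_cst (leb2 R) mcell) [leRHS]integral_mkcond.
apply: ge0_le_integral => //.
- apply/measurable_EFinP; apply: (measurableT_comp (measurable_powR 2)).
  apply: measurableT_comp => //.
  by apply/(measurable_restrictT f mcell); apply: measurable_funTS.
- by apply/(measurable_restrictT _ mcell); exact: measurable_cst.
move=> p _; rewrite !patchE; case: ifPn => _; last by rewrite normr0 powR0.
by rewrite lee_fin powR_mulrn// lerXn2r ?nnegrE.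
Qed.

Lemma H2norm_le f d M : 0 <= M -> weak_jet2 f d ->
  (forall i j, (i + j <= 2)%N -> (L2norm (d i j) <= M%:E)%E) ->
  (H2norm f <= (3 * M)%:E)%E.
Proof.
move=> M0 jet dM; apply: le_trans.
  by apply: ereal_inf_lbound; exists d; [exact: jet|reflexivity].
have L0 i j : (0 <= L2norm (d i j))%E by exact: Lnorm_ge0.
have -> : ((3 * M)%:E = ((3 * M) ^+ 2)%:E `^ 2^-1)%E.
  rewrite poweR_EFin -powR_mulrn ?mulr_ge0// -powRrM mulfV// powRr1// mulr_ge0//.
apply: gt0_ler_poweR; rewrite ?in_itv/= ?leey ?andbT//.
- by apply: sume_ge0 => i _; apply: sume_ge0 => j _; rewrite mule_ge0.
- by rewrite lee_fin exprn_ge0// mulr_ge0.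
(* The sum is enlarged to all nine pairs, whence the factor 3. *)
apply: (@le_trans _ _ (\sum_(i < 3) \sum_(j < 3) (M ^+ 2)%:E)%E); last first.
  by rewrite !big_ord_recl !big_ord0 !adde0 -!EFinD lee_fin; nra.
apply: lee_sum => i _; rewrite big_mkcond; apply: lee_sum => j _.
case: ifPn => ij; last by rewrite lee_fin exprn_ge0.
by rewrite expr2 EFinM lee_pmul//; exact: dM.
Qed.

End SobolevBounds.

(** * Weak jets of uniform limits *)

Section Jets.
Variables (R : realType) (V : nat -> cpoly R) (B : R).
Hypothesis VB : forall i j n p, (i + j <= 2)%N ->
  `|cev i j (V n.+1) p - cev i j (V n) p| <= B / 2 ^+ n.

Definition clim (i j : nat) (p : R * R) : R := lim (cev i j (V n) p @[n --> \oo]).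

Lemma cvg_clim i j p : (i + j <= 2)%N -> cev i j (V n) p @[n --> \oo] --> clim i j p.
Proof. by move=> ij; exact: (cvg_increments_geometric (fun n => VB n p ij)).1. Qed.

Lemma clim_dist i j p n : (i + j <= 2)%N ->
  `|clim i j p - cev i j (V n) p| <= 2 * B / 2 ^+ n.
Proof. by move=> ij; exact: (cvg_increments_geometric (fun n => VB n p ij)).2. Qed.

Lemma clim_bound i j p : (i + j <= 2)%N ->
  `|clim i j p| <= `|cev i j (V 0) p| + 2 * B.
Proof.
move=> ij; rewrite addrC -[X in `|X|](subrK (cev i j (V 0) p)).
apply: le_trans (ler_normD _ _) _; rewrite lerD2r.
by apply: le_trans (clim_dist p 0 ij) _; rewrite expr0 divr1.
Qed.

Lemma increment_bound_ge0 : 0 <= B.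
Proof. by have := @VB 0 0 0 (0, 0) isT; rewrite expr0 divr1; exact: le_trans. Qed.

Lemma measurable_clim i j : (i + j <= 2)%N -> measurable_fun setT (clim i j).
Proof.
move=> ij; apply: (measurable_fun_cvg (h := fun n => cev i j (V n))).
  by move=> n; apply: continuous_measurable2; exact: continuous_cev.
by move=> p _; exact: cvg_clim.
Qed.

Lemma L2per_clim i j : (i + j <= 2)%N -> L2per (clim i j).
Proof.
move=> ij; split; last first.
- have b p : `|clim i j p| <= w2norm (V 0) + 2 * B.
    by apply: le_trans (clim_bound p ij) _; rewrite lerD2r ler_cev.
  apply: le_lt_trans (L2norm_le _ (measurable_clim ij) b) (ltry _).
  by rewrite addr_ge0 ?w2norm_ge0// mulr_ge0// increment_bound_ge0.
- exact: measurable_clim.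
move=> p; split; rewrite /clim.
- rewrite (_ : (fun n => cev i j (V n) _) = (fun n => cev i j (V n) p))//.
  by apply/funext => n; exact: (periodic2_cev i j (V n) p).1.
- rewrite (_ : (fun n => cev i j (V n) _) = (fun n => cev i j (V n) p))//.
  by apply/funext => n; exact: (periodic2_cev i j (V n) p).2.
Qed.

Lemma cvg_integral_clim i j g : (i + j <= 2)%N -> continuous g ->
  \int[leb2 R]_(p in @cell R) (cev i j (V n) p * g p) @[n --> \oo]
    --> \int[leb2 R]_(p in @cell R) (clim i j p * g p).
Proof.
move=> ij cg; have [G gG] := continuous_cell_bounded cg.
have mcell : measurable (@cell R : set (measurableTypeR R * measurableTypeR R)).
  exact: measurable_cell.
have mg := continuous_measurable2 cg.
have iV n : (leb2 R).-integrable (@cell R) (EFin \o (fun p => cev i j (V n) p * g p)).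
  apply: continuous_cell_integrable => p.
  by apply: cvgM; [exact: continuous_cev|exact: cg].
have iF : (leb2 R).-integrable (@cell R) (EFin \o (fun p => clim i j p * g p)).
  apply: (@bounded_cell_integrable _ _ ((w2norm (V 0) + 2 * B) * G)).
    by apply: measurable_funM => //; exact: measurable_clim.
  move=> p cp; rewrite normrM; apply: ler_pM => //; last exact: gG.
  by apply: le_trans (clim_bound p ij) _; rewrite lerD2r ler_cev.
(* Uniform convergence on a cell of finite measure gives an explicit geometric rate for the
   integrals. *)
apply: (@cvg_dist_geometric _ _ _ (2 * B * G * fine (leb2 R (@cell R)))) => n.
rewrite -RintegralB//.
have iD : (leb2 R).-integrable (@cell R)
    (EFin \o (fun p => cev i j (V n) p * g p - clim i j p * g p)).
  have := integrableB mcell (iV n) iF; apply: eq_integrable => //.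
apply: le_trans (le_normr_Rintegral mcell iD) _.
have -> : 2 * B * G * fine (leb2 R (@cell R)) / 2 ^+ n
    = \int[leb2 R]_(p in @cell R) (2 * B / 2 ^+ n * G).
  by rewrite Rintegral_cst//; ring.
apply: le_Rintegral => //.
- exact: (integrable_norm iD).
- apply: continuous_cell_integrable => p; exact: cvg_cst.
move=> p cp; rewrite -mulrBl normrM; apply: ler_pM => //; last exact: gG.
by rewrite distrC clim_dist.
Qed.

(** Both sides of the integration by parts identity for [V n] converge, and limits are unique. *)
Lemma weak_jet2_clim : weak_jet2 (clim 0 0) clim.
Proof.
split=> [|i j ij]; first exact: L2per_clim.
split; first exact: L2per_clim.
move=> psi tpsi.
have tD : test_function (iter i (@dx R) (iter j (@dy R) psi)).
  by apply: test_function_iter_dx; exact: test_function_iter_dy.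
have c0 := @cvg_integral_clim 0 0 _ isT (test_function_continuous tD).
have c1 : (-1) ^+ (i + j) * \int[leb2 R]_(p in @cell R) (cev i j (V n) p * psi p)
    @[n --> \oo] --> (-1) ^+ (i + j) * \int[leb2 R]_(p in @cell R) (clim i j p * psi p).
  apply: cvgM; first exact: cvg_cst.
  exact: cvg_integral_clim ij (test_function_continuous tpsi).
move: c0; under eq_fun do rewrite (weak_deriv_cev _ ij tpsi).
move=> /(cvg_lim (@Rhausdorff R)) <-; exact: cvg_lim c1.
Qed.

End Jets.

(** * The bifurcating branch *)

Section Branch.
Variables (R : realType) (a : R).
Hypothesis a01 : 0 < a <= 1 / 156.
Implicit Types p : R * R.

Let iterate n := iter n (step a) (init a).
Let U n := (iterate n).1.1.
Let D n := (iterate n).1.2.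
Let q n := (iterate n).2.

Definition plim : R := lim (q n @[n --> \oo]).
Definition freq : R := 2 - a * plim.

(* [c0 + a (U n - k start)]: with [c0 = freq], [k = 0] it tends to the solution, and
   with [c0 = freq - c_approx a], [k = 1] to its difference with [phi_approx a]. *)
Definition affine_iterate (c0 k : R) n : cpoly R :=
  [:: (c0, (0, 0)%N)] ++ cpscale a (U n ++ cpscale (- k) (start a)).

Definition branch : R * R -> R := clim (affine_iterate freq 0) 0 0.

Let a156 : 0 <= a <= 1 / 156.
Proof. by have /andP[a0 ->] := a01; rewrite ltW. Qed.

Let a_ge0 : 0 <= a. Proof. by case/andP: a156. Qed.

Let iterate_inv n :
  [/\ approx_sol a (iterate n), in_ball (iterate n)
    & w2norm (D n) <= 12 * a ^+ 3 / 2 ^+ n].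
Proof.
elim: n => [|n [sol ball dn]].
  rewrite expr0 divr1; split; [exact: init_approx_sol|exact: init_in_ball|].
  exact: (w2norm_init a156).1.
have [ball' dS _] := step_contract a156 ball.
split; [exact: step_approx_sol|exact: ball'|].
by apply: le_trans dS _; rewrite -/(D n) (exprSr 2 n) invfM mulrA ler_wpM2r// invr_ge0.
Qed.

Let US n : U n.+1 = U n ++ D n. Proof. by []. Qed.

Let plim_dist : q n @[n --> \oo] --> plim /\
  forall n, `|plim - q n| <= 144 * a ^+ 3 / 2 ^+ n.
Proof.
have qS n : `|q n.+1 - q n| <= 72 * a ^+ 3 / 2 ^+ n.
  have [_ ball dn] := iterate_inv n; have [_ _ dq] := step_contract a156 ball.
  apply: le_trans dq _; rewrite -/(D n).
  rewrite (_ : 72 * a ^+ 3 / 2 ^+ n = 6 * (12 * a ^+ 3 / 2 ^+ n)); last by ring.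
  by rewrite ler_pM2l.
have [cq dq] := cvg_increments_geometric qS; split => // n.
apply: le_trans (dq n) _; rewrite (_ : 2 * (72 * a ^+ 3) = 144 * a ^+ 3)//.
by ring.
Qed.

(** [145 = 144 + 1]: the distance from [q 0] to [plim], plus that from [q 0] to [a / 48]. *)
Lemma freq_dist : `|freq - c_approx a| <= 145 * a ^+ 4.
Proof.
have [_ /(_ 0%N)] := plim_dist; rewrite expr0 divr1 => pq.
have [_ q0] := w2norm_init a156.
have -> : freq - c_approx a = - a * (plim - a / 48).
  by rewrite /freq /c_approx; field.
rewrite normrM normrN (ger0_norm a_ge0).
rewrite (_ : 145 * a ^+ 4 = a * (145 * a ^+ 3)); last by ring.
apply: ler_wpM2l => //.
by have := ler_distD (q 0) plim (a / 48); move: pq q0; rewrite -/(q 0); lra.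
Qed.

(** The terms in [c0] and [k] do not depend on [n] and cancel, leaving [a] times the increment
    [D n]. *)
Lemma affine_iterate_increment c0 k i j n p : (i + j <= 2)%N ->
  `|cev i j (affine_iterate c0 k n.+1) p - cev i j (affine_iterate c0 k n) p|
    <= 12 * a ^+ 4 / 2 ^+ n.
Proof.
move=> ij; rewrite !cev_cat !cev_scale US !cev_cat.
rewrite (_ : _ - _ = a * cev i j (D n) p); last by ring.
rewrite normrM (ger0_norm a_ge0).
have [_ _ dn] := iterate_inv n.
rewrite (_ : 12 * a ^+ 4 / 2 ^+ n = a * (12 * a ^+ 3 / 2 ^+ n)); last by ring.
by apply: ler_wpM2l; [exact: a_ge0|exact: le_trans (ler_cev _ _ ij) dn].
Qed.

Let cev00_affine c0 k n p : cev 0 0 (affine_iterate c0 k n) p =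
  c0 + a * (cev 0 0 (U n) p - k * cev 0 0 (start a) p).
Proof.
rewrite cev_cat cev_scale cev_cat cev_scale cev_cons cev_nil /= !mul0r cos0.
by ring.
Qed.

Lemma cev_sym s p : cev 0 0 s (- p.1, p.2) = cev 0 0 s p /\
  cev 0 0 s (p.1, - p.2) = cev 0 0 s p.
Proof. by split; apply: eq_bigr => t _ /=; rewrite mulrN cosN. Qed.

Lemma branch_sym p : branch (- p.1, p.2) = branch p /\ branch (p.1, - p.2) = branch p.
Proof.
pose V := affine_iterate freq 0.
split; rewrite /branch /clim;
  rewrite (_ : (fun n => cev 0 0 (V n) _) = (fun n => cev 0 0 (V n) p))//;
  by apply/funext => n; have [] := cev_sym (V n) p.
Qed.

Lemma branch_pde p : let d := clim (affine_iterate freq 0) in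
  - (d 2%N 0%N p + d 0%N 2%N p) + freq * branch p - branch p ^+ 2 = 0.
Proof.
move=> d; pose V := affine_iterate freq 0.
have cV i j (ij : (i + j <= 2)%N) := cvg_clim (affine_iterate_increment freq 0) (p := p) ij.
have cVS i j (ij : (i + j <= 2)%N) :
    cev i j (V n.+1) p @[n --> \oo] --> d i j p.
  by rewrite (cvg_shiftS (fun n => cev i j (V n) p)); exact: cV.
(* The Picard relation rewritten for [V n - freq = a U n]. In the limit, [a * plim = 2 - freq] turns
   it into the equation for [branch]. *)
have eqn n : - (cev 2 0 (V n.+1) p + cev 0 2 (V n.+1) p) =
    2 * (cev 0 0 (V n.+1) p - freq) + (cev 0 0 (V n) p - freq) ^+ 2
    - a * q n * (cev 0 0 (V n) p - freq).
  have [[_ _ /(_ p) E] _ _] := iterate_inv n.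
  have : - (cev 2 0 (V n.+1) p + cev 0 2 (V n.+1) p)
      = a * (- (cev 2 0 (U n.+1) p + cev 0 2 (U n.+1) p)).
    by rewrite /V !cev_cat !cev_scale !cev_cat !cev_scale !cev_cons !cev_nil /=; ring.
  move=> ->; rewrite !cev00_affine.
  move: E; rewrite /lapm2 -US -/(U n) -/(q n) => /(canRL (subrK _)) ->.
  by ring.
have [cq _] := plim_dist.
have lhs : - (cev 2 0 (V n.+1) p + cev 0 2 (V n.+1) p) @[n --> \oo]
    --> - (d 2%N 0%N p + d 0%N 2%N p).
  by apply: cvgN; apply: cvgD; exact: cVS.
have c1 : cev 0 0 (V n) p - freq @[n --> \oo] --> branch p - freq.
  by apply: cvgB; [exact: cV|exact: cvg_cst].
have rhs : 2 * (cev 0 0 (V n.+1) p - freq) + (cev 0 0 (V n) p - freq) ^+ 2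
    - a * q n * (cev 0 0 (V n) p - freq) @[n --> \oo] -->
    2 * (branch p - freq) + (branch p - freq) * (branch p - freq)
    - a * plim * (branch p - freq).
  apply: cvgB.
    apply: cvgD; last by apply: cvgM.
    apply: cvgM; first exact: cvg_cst.
    by apply: cvgB; [exact: cVS|exact: cvg_cst].
  by apply: cvgM => //; apply: cvgM => //; exact: cvg_cst.
move: lhs; under eq_fun do rewrite eqn.
move=> /(cvg_lim (@Rhausdorff R)) <-; rewrite (cvg_lim (@Rhausdorff R) rhs).
by rewrite /freq; ring.
Qed.

(** The constant [- 7 / 6] splits as [- 1 - 1 / 6]: the first part comes from [z1], the second from
    [- a^2 / 48] in [c_approx]. *)
Lemma phi_approxE p : phi_approx a p = c_approx a + a * cev 0 0 (start a) p.
Proof.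
rewrite /start !cev_cat !cev_scale cev_e11 cev_z1 cev_z2 /phi_approx /c_approx /cc.
by field.
Qed.

(** As a limit of cosine polynomials itself, the difference gets its weak jet and bounds
    directly. *)
Lemma branch_sub_approx :
  (fun p => branch p - phi_approx a p) =
  clim (affine_iterate (freq - c_approx a) 1) 0 0.
Proof.
apply/funext => p; apply/esym; apply: (cvg_lim (@Rhausdorff R)).
have -> : (fun n => cev 0 0 (affine_iterate (freq - c_approx a) 1 n) p) =
    (fun n => cev 0 0 (affine_iterate freq 0 n) p - phi_approx a p).
  by apply/funext => n; rewrite !cev00_affine phi_approxE; ring.
apply: cvgB; last exact: cvg_cst.
exact: (cvg_clim (affine_iterate_increment freq 0)).
Qed.

Lemma branch_solves : H2pers branch /\ solves freq branch.
Proof.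
have jet := weak_jet2_clim (affine_iterate_increment freq 0).
split; last by eexists; [exact: jet|apply: aeW => p; exact: branch_pde].
split; first by eexists; exact: jet.
- by apply: aeW => p; exact: (branch_sym p).1.
- by apply: aeW => p; exact: (branch_sym p).2.
Qed.

Lemma branch_error :
  (H2norm (fun p => branch p - phi_approx a p)%R <= (1014 * pi * a ^+ 4)%:E)%E.
Proof.
rewrite branch_sub_approx; set V := affine_iterate _ _.
have inc i j n p := @affine_iterate_increment (freq - c_approx a) 1 i j n p.
have a4 : 0 <= a ^+ 4 by exact: exprn_ge0.
(* Since [U 0 = start a] and [k = 1], [V 0] reduces to the constant [freq - c_approx a]. *)
have V0 i j p : `|cev i j (V 0%N) p| <= 145 * a ^+ 4.
  rewrite cev_cat cev_scale cev_cat cev_scale mulN1r subrr mulr0 addr0.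
  apply: le_trans freq_dist; rewrite cev_cons cev_nil addr0 normrM ler_piMr//.
  case: i => [|[|i]]; case: j => [|[|j]] /=;
    by rewrite ?expr0n ?oppr0 ?mul0r ?mulr0 ?cos0 ?mulr1 ?normr0 ?normr1.
(* [169 = 145 + 2 * 12], the second term being the sum of all increments. *)
have bound i j p : (i + j <= 2)%N -> `|clim V i j p| <= 169 * a ^+ 4.
  move=> ij; apply: le_trans (clim_bound inc p ij) _.
  by have := V0 i j p; lra.
have -> : 1014 * pi * a ^+ 4 = 3 * (169 * a ^+ 4 * (2 * pi)) by ring.
apply: (H2norm_le _ (weak_jet2_clim inc)).
  by rewrite !mulr_ge0 ?pi_ge0.
move=> i j ij; apply: L2norm_le; first by rewrite mulr_ge0.
  exact: (measurable_clim inc ij).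
by move=> p; exact: bound.
Qed.

End Branch.

Theorem proposition2p8 (R : realType) :
  exists (a0 : R) (phi : R -> R * R -> R) (c : R -> R),
    [/\ 0 < a0,
        forall a : R, 0 < a < a0 -> H2pers (phi a) /\ solves (c a) (phi a),
        bigO_at_right0 4 (fun a => H2norm (fun p => phi a p - phi_approx a p))
      & bigO_at_right0 4 (fun a => `|c a - c_approx a|%:E)].
Proof.
have near0 : \forall a \near (0 : R)^'+, 0 < a <= 1 / 156.
  near=> a; apply/andP; split; first by near: a; exact: nbhs_right_gt.
  by near: a; apply: nbhs_right_le; rewrite divr_gt0.
exists (1 / 156), (@branch R), (@freq R); split.
- by rewrite divr_gt0.
- by move=> a /andP[a0 /ltW a1]; apply: branch_solves; rewrite a0.
- by exists (1014 * pi); apply: filterS near0 => a; exact: branch_error.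
- by exists 145; apply: filterS near0 => a a01; rewrite lee_fin; exact: freq_dist.
Unshelve. all: by end_near. Qed.
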